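(* Let $K$ be a field of characteristic $0$ and let $\alpha\in K$. Then the elliptic Poisson algebra $E_\alpha$ does not have any nonzero locally nilpotent derivations.
   Context: For $\alpha\in K$ put $C=\frac13(x^3+y^3+z^3)-\alpha xyz\in K[x,y,z]$. The elliptic Poisson algebra $E_\alpha$ is the polynomial algebra $K[x,y,z]$ endowed with the Poisson bracket determined by $\{x,y\}=-\alpha xy+z^2$, $\{y,z\}=-\alpha yz+x^2$, $\{z,x\}=-\alpha zx+y^2$; equivalently $\{u,v\}=J(u,v,C)$ for all $u,v\in K[x,y,z]$, where $J(f_1,f_2,f_3)$ is the determinant of the Jacobian matrix of $(f_1,f_2,f_3)$ with respect to $(x,y,z)$. A derivation of a Poisson algebra $P$ over $K$ is a $K$-linear map $D:P\to P$ such that $D(ab)=D(a)b+aD(b)$ and $D(\{a,b\})=\{D(a),b\}+\{a,D(b)\}$ for all $a,b\in P$. A derivation $D$ is called locally nilpotent if for every $a\in P$ there exists a natural number $m=m(a)$ such that $D^m(a)=0$. *)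

(* Defs.v *)
From mathcomp Require Import all_boot all_order all_algebra.
From mathcomp Require Import mpoly ring.

Set Implicit Arguments.
Unset Strict Implicit.
Unset Printing Implicit Defensive.

Import GRing.Theory.
Local Open Scope ring_scope.

Section PoissonAlgebra.

Variables (K : fieldType) (A : comAlgType K).
Implicit Types (br : A -> A -> A) (D : {linear A -> A}).

(* Linearity and the Leibniz rule are required on the left only: the bracket
   is alternating. *)
Definition poisson_bracket br : Prop :=
  [/\ forall (k : K) (a b c : A), br (k *: a + b) c = k *: br a c + br b c,
      forall a : A, br a a = 0,
      forall a b c : A, br (a * b) c = a * br b c + br a c * b
    & forall a b c : A, br a (br b c) + br b (br c a) + br c (br a b) = 0].

Definition poisson_derivation br D : Prop :=
  (forall a b : A, D (a * b) = D a * b + a * D b) /\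
  (forall a b : A, D (br a b) = br (D a) b + br a (D b)).

Definition locally_nilpotent D : Prop :=
  forall a : A, exists m : nat, iter m D a = 0.

End PoissonAlgebra.

Section JacobianIdentities.

Variable R : comNzRingType.

Let jac (f0 f1 f2 g0 g1 g2 h0 h1 h2 : R) :=
  f0 * (g1 * h2 - g2 * h1) - f1 * (g0 * h2 - g2 * h0)
  + f2 * (g0 * h1 - g1 * h0).

Fact jac_linear k a0 a1 a2 b0 b1 b2 g0 g1 g2 h0 h1 h2 :
  jac (k * a0 + b0) (k * a1 + b1) (k * a2 + b2) g0 g1 g2 h0 h1 h2 =
  k * jac a0 a1 a2 g0 g1 g2 h0 h1 h2 + jac b0 b1 b2 g0 g1 g2 h0 h1 h2.
Proof. by rewrite /jac; ring. Qed.

Fact jac_alt a0 a1 a2 h0 h1 h2 : jac a0 a1 a2 a0 a1 a2 h0 h1 h2 = 0.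
Proof. by rewrite /jac; ring. Qed.

Fact jac_leibniz a b a0 a1 a2 b0 b1 b2 g0 g1 g2 h0 h1 h2 :
  jac (a0 * b + a * b0) (a1 * b + a * b1) (a2 * b + a * b2)
    g0 g1 g2 h0 h1 h2 =
  a * jac b0 b1 b2 g0 g1 g2 h0 h1 h2 + jac a0 a1 a2 g0 g1 g2 h0 h1 h2 * b.
Proof. by rewrite /jac; ring. Qed.

Variables d0 d1 d2 : R -> R.

Let br c a b :=
  jac (d0 a) (d1 a) (d2 a) (d0 b) (d1 b) (d2 b) (d0 c) (d1 c) (d2 c).

Fact jac_jacobi :
  {morph d0 : x y / x + y} -> {morph d1 : x y / x + y} ->
  {morph d2 : x y / x + y} -> {morph d0 : x / - x} ->
  {morph d1 : x / - x} -> {morph d2 : x / - x} ->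
  (forall x y, d0 (x * y) = d0 x * y + x * d0 y) ->
  (forall x y, d1 (x * y) = d1 x * y + x * d1 y) ->
  (forall x y, d2 (x * y) = d2 x * y + x * d2 y) ->
  (forall x, d1 (d0 x) = d0 (d1 x)) -> (forall x, d2 (d0 x) = d0 (d2 x)) ->
  (forall x, d2 (d1 x) = d1 (d2 x)) ->
  forall h a b c, br h a (br h b c) + br h b (br h c a) + br h c (br h a b) = 0.
Proof.
move=> D0 D1 D2 N0 N1 N2 M0 M1 M2 c10 c20 c21 h a b c; rewrite /br /jac.
rewrite !(D0, D1, D2, N0, N1, N2, M0, M1, M2) !(c10, c20, c21).
by ring.
Qed.

End JacobianIdentities.

Section Elliptic.

Variables (K : fieldType) (alpha : K).

Definition vx : {mpoly K[3]} := 'X_(0 : 'I_3).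
Definition vy : {mpoly K[3]} := 'X_(1 : 'I_3).
Definition vz : {mpoly K[3]} := 'X_(2 : 'I_3).

Definition jacobian (f1 f2 f3 : {mpoly K[3]}) : {mpoly K[3]} :=
  \det (\matrix_(i < 3, j < 3) (nth 0 [:: f1; f2; f3] i)^`M(j)).

Definition elliptic_cubic : {mpoly K[3]} :=
  (3%:R : K)^-1 *: (vx ^+ 3 + vy ^+ 3 + vz ^+ 3) - alpha *: (vx * vy * vz).

Definition elliptic_bracket (u v : {mpoly K[3]}) : {mpoly K[3]} :=
  jacobian u v elliptic_cubic.

Lemma jacobianE (f g h : {mpoly K[3]}) :
  jacobian f g h =
    f^`M(0 : 'I_3)
      * (g^`M(1 : 'I_3) * h^`M(2 : 'I_3) - g^`M(2 : 'I_3) * h^`M(1 : 'I_3))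
  - f^`M(1 : 'I_3)
      * (g^`M(0 : 'I_3) * h^`M(2 : 'I_3) - g^`M(2 : 'I_3) * h^`M(0 : 'I_3))
  + f^`M(2 : 'I_3)
      * (g^`M(0 : 'I_3) * h^`M(1 : 'I_3) - g^`M(1 : 'I_3) * h^`M(0 : 'I_3)).
Proof.
pose N i j := (nth 0 [:: f; g; h] i)^`M(inord j : 'I_3).
rewrite /jacobian; set M := (X in \det X).
have ME i j : M i j = N i j by rewrite mxE /N inord_val.
have -> : (2 : 'I_3) = inord 2%N by apply/val_inj; rewrite [RHS]inordK.
have -> : (1 : 'I_3) = inord 1%N by apply/val_inj; rewrite [RHS]inordK.
have -> : (0 : 'I_3) = inord 0%N by apply/val_inj; rewrite [RHS]inordK.
clearbody M.
do !rewrite (expand_det_row _ ord0) !big_ord_recl big_ord0 /cofactor /=.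
rewrite !det_mx00 !mxE !ME /= /bump /= /N /=.
by ring.
Qed.

Let mderivV (i j : 'I_3) : ('X_i : {mpoly K[3]})^`M(j) = (i == j)%:R.
Proof.
rewrite mderivX mnm1E; case: eqP => [->|_]; last by rewrite scale0r.
by rewrite scale1r -{1}[U_(j)%MM]add0m addmK mpolyX0.
Qed.

Lemma elliptic_cubic_deriv : [pchar K] =i pred0 ->
  [/\ elliptic_cubic^`M(0 : 'I_3) = vx ^+ 2 - alpha *: (vy * vz),
      elliptic_cubic^`M(1 : 'I_3) = vy ^+ 2 - alpha *: (vz * vx)
    & elliptic_cubic^`M(2 : 'I_3) = vz ^+ 2 - alpha *: (vx * vy)].
Proof.
move=> char0.
have n3 : (3%:R : K) != 0 by rewrite ((pcharf0P _).1 char0).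
have c3 : ((3%:R : K)^-1)%:MP_[3] * 3%:R = 1.
  by rewrite -mpolyC_nat -mpolyCM mulVf // mpolyC1.
rewrite /elliptic_cubic /vx /vy /vz !exprS !expr0 !mulr1.
split; rewrite mderivB !mderivZ !mderivD !mderivM !mderivV /= -!mul_mpolyC;
  move: c3; set c := _%:MP; move: c (alpha%:MP) => c d;
  move: ('X_0 : {mpoly K[3]}) 'X_1 'X_2 => X Y Z c3; by ring: c3.
Qed.

Lemma elliptic_bracket_gen : [pchar K] =i pred0 ->
  [/\ elliptic_bracket vx vy = - (alpha *: (vx * vy)) + vz ^+ 2,
      elliptic_bracket vy vz = - (alpha *: (vy * vz)) + vx ^+ 2
    & elliptic_bracket vz vx = - (alpha *: (vz * vx)) + vy ^+ 2].
Proof.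
move=> char0; have [cx cy cz] := elliptic_cubic_deriv char0.
by split; rewrite /elliptic_bracket jacobianE cx cy cz !mderivV /=; ring.
Qed.

Lemma elliptic_bracket_poisson : poisson_bracket elliptic_bracket.
Proof.
rewrite /elliptic_bracket.
split=> [k a b c|a|a b c|a b c]; rewrite !jacobianE.
- rewrite !mderivD !mderivZ -!mul_mpolyC; exact: jac_linear.
- exact: jac_alt.
- rewrite !mderivM; exact: jac_leibniz.
apply: (jac_jacobi (d0 := mderiv 0) (d1 := mderiv 1) (d2 := mderiv 2));
  by [exact: mderivD | exact: mderivN | exact: mderivM | exact: mderiv_comm].
Qed.

End Elliptic.

(* Main.v *)
Require Import Defs.
From HB Require Import structures.
From mathcomp Require Import all_boot all_order all_algebra all_field.
From mathcomp Require Import mpoly.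
From mathcomp Require Import generic_quotient fraction ring zify.

(** Let D be a locally nilpotent Poisson derivation, C the cubic of which the
    bracket is the Jacobian, and c = 3C = x^3 + y^3 + z^3 - 3 alpha xyz.

    The Poisson condition serves only to show DC = 0 ([derivation_cubic]). As C is
    a Casimir, so are all the D^k C. The gradient of a Casimir is
    parallel to that of C, which forces DC, unless it is zero, to divide the coprime
    partial derivatives of C and so not to vanish at the origin; but
    DC = sum of the D(x_i) dC/dx_i vanishes there.

    The rest holds for every locally nilpotent derivation that kills c. Its tool
    is the exponential psi(a) = sum of the D^i(a)/i! t^i, a ring morphism
    into polynomials in t ([flow_exists]).

    If alpha^3 = 1 ([nodal_case]), c is a product of a linear form and of a
    quadratic form q, both killed by D because their product is
    ([factorially_closed]). As 4q = a^2 + 3b^2 for linear forms a and b, these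
    are killed too ([derivation_sum_squares]), and the three linear forms
    span all of them.

    If alpha^3 <> 1 ([smooth_case]), c = 0 is a cone over a smooth plane cubic,
    hence over a curve of genus 1. Its generic point ([generic_point]) turns
    psi(x), psi(y), psi(z) into polynomials in t over a field that satisfy the
    equation of the cubic. Such a curve v(t) is constant up to a scalar factor:
    v x v' is a multiple of the gradient of the cubic at v, and its degree is
    too small for a nonzero one ([hesse_curve]). It follows that D is divisible by c
    ([smooth_step]). The quotient is again a locally nilpotent
    derivation killing c, so D is divisible by every power of c, hence zero. *)

Set Implicit Arguments.
Unset Strict Implicit.
Unset Printing Implicit Defensive.

Import GRing.Theory Pdiv.RingMonic Pdiv.Ring.
Local Open Scope ring_scope.
Local Open Scope quotient_scope.

Local Notation "x %:F" := (@FracField.tofrac _ x).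
Local Notation vx := (vx _).
Local Notation vy := (vy _).
Local Notation vz := (vz _).

(** * Polynomial curves on a smooth plane cubic *)

(** The conclusion is rotated so that three uses square all three entries. *)
Lemma unimodular_sqr (R : comNzRingType) (u v w x y z : R) :
  u * x + v * y + w * z = 1 ->
  exists u' v' w', u' * y + v' * z + w' * x ^+ 2 = 1.
Proof.
move=> e.
exists (v * (u * x + 1 + w * z)), (w * (1 + u * x - v * y)), (u ^+ 2).
transitivity (u * x * (u * x + v * y + w * z) + (v * y + w * z)); first by ring.
by rewrite e mulr1 addrA.
Qed.

Lemma unimodular_X4 (R : comNzRingType) (u v w x y z : R) :
  u * x + v * y + w * z = 1 ->
  exists u' v' w', u' * x ^+ 4 + v' * y ^+ 4 + w' * z ^+ 4 = 1.
Proof.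
do 6![move=> /unimodular_sqr[{}u [{}v [{}w]]]] => e.
by exists u, v, w; rewrite -[RHS]e; ring.
Qed.

Lemma size_mul_leq (R : nzRingType) m k (p q : {poly R}) :
  (size p <= m.+1)%N -> (size q <= k)%N -> (size (p * q)%R <= m + k)%N.
Proof.
move=> hp hq; apply: leq_trans (size_polyMleq p q) _; lia.
Qed.

Section HesseCurve.
Variables (E : fieldType) (al : E).
Hypotheses (n3 : (3%:R : E) != 0) (al3 : al ^+ 3 != 1).
Implicit Types a b c : {poly E}.

(** Degree at most 2n - 1, because of the derivative: this is below the degree 2n
    of the gradient of a smooth cubic along a curve of degree n. *)
Lemma size_wronskian n a b : (size a <= n.+1)%N -> (size b <= n.+1)%N ->
  (size (a * b^`() - b * a^`())%R <= n.*2)%N.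
Proof.
have h (p q : {poly E}) : (size p <= n.+1)%N -> (size q <= n.+1)%N ->
    (size (p * q^`())%R <= n.*2)%N.
  move=> hp hq; rewrite -addnn size_mul_leq //.
  have [->|q0] := eqVneq q 0; first by rewrite deriv0 size_poly0.
  by rewrite -ltnS (leq_trans (lt_size_deriv q0)).
move=> ha hb; apply: leq_trans (size_polyD _ _) _.
by rewrite geq_max size_polyN !h.
Qed.

(** Effective Nullstellensatz for a smooth cubic: when l ^+ 3 <> 1 the three
    partial derivatives have no common zero but the origin, so that a power of
    each variable lies in the ideal they generate. It comes from eliminating
    with a ^+ 2 = l b c, b ^+ 2 = l c a and c ^+ 2 = l a b. *)
Lemma hesse_gradient_X4 (R : comNzRingType) (l a b c : R) :
  (1 - l ^+ 3) * a ^+ 4 =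
  ((1 - l ^+ 3) * a ^+ 2 + l * (b * c)) * (a ^+ 2 - l * (b * c))
  + (l ^+ 2 * c ^+ 2) * (b ^+ 2 - l * (c * a))
  + (l ^+ 3 * (c * a)) * (c ^+ 2 - l * (a * b)).
Proof. by ring. Qed.

(** A drop in the degree of all three partial derivatives would contradict the
    degrees of the two sides of [hesse_gradient_X4]. *)
Lemma size_hesse_gradient n a b c (l := al%:P) :
  (size b <= n.+1)%N -> (size c <= n.+1)%N -> size a = n.+1 ->
  (size (a ^+ 2 - l * (b * c))%R <= n.*2)%N ->
  (size (b ^+ 2 - l * (c * a))%R <= n.*2)%N ->
  (size (c ^+ 2 - l * (a * b))%R <= n.*2)%N -> False.
Proof.
move=> hb hc ha.
have a0 : a != 0 by rewrite -size_poly_gt0 ha.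
have := hesse_gradient_X4 l a b c.
set G1 := a ^+ 2 - _; set G2 := b ^+ 2 - _; set G3 := c ^+ 2 - _.
move=> e h1 h2 h3.
have sz k (p q : {poly E}) : (size p <= n.+1)%N -> (size q <= n.+1)%N ->
    (size (k%:P * (p * q))%R <= n.*2.+1)%N.
  move=> hp hq; rewrite mul_polyC (leq_trans (size_scale_leq _ _)) //.
  by rewrite -addnn -addnS size_mul_leq.
have ha' : (size a <= n.+1)%N by rewrite ha.
suff : (size ((1 - l ^+ 3) * a ^+ 4)%R <= n.*2 + n.*2)%N.
  rewrite /l -polyC1 -rmorphXn -rmorphB mul_polyC size_scale ?subr_eq0 1?eq_sym //.
  have : (0 < size (a ^+ 4))%N by rewrite size_poly_gt0 expf_neq0.
  by have := size_exp a 4; rewrite ha /= -!addnn; case: (size (a ^+ 4)) => // k /= ->; lia.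
rewrite e {e}; do 2?[apply: leq_trans (size_polyD _ _) _; rewrite geq_max; apply/andP; split].
- apply: size_mul_leq => //; apply: leq_trans (size_polyD _ _) _.
  rewrite geq_max sz // andbT /l -polyC1 -rmorphXn -rmorphB expr2 sz //.
- by apply: size_mul_leq => //; rewrite /l -rmorphXn expr2 sz.
- by apply: size_mul_leq => //; rewrite /l -rmorphXn sz.
Qed.

(** With v = (a, b, c) and G the gradient of the cubic at v, Euler's formula
    and differentiation of the equation give G . v = G . v' = 0, so v x v' is
    proportional to G. As G is unimodular, the factor is a polynomial M; since
    v x v' has smaller degree than G, M = 0. *)
Lemma hesse_primitive a b c (u v w : {poly E}) :
  a ^+ 3 + b ^+ 3 + c ^+ 3 = 3%:R * al%:P * (a * b * c) ->
  u * a + v * b + w * c = 1 -> a * b^`() = b * a^`().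
Proof.
move=> e /unimodular_X4[{}u [{}v [{}w huvw]]]; set l := al%:P in e.
pose G1 := a ^+ 2 - l * (b * c); pose G2 := b ^+ 2 - l * (c * a).
pose G3 := c ^+ 2 - l * (a * b).
pose W1 := b * c^`() - c * b^`(); pose W2 := c * a^`() - a * c^`().
pose W3 := a * b^`() - b * a^`().
have n3P : (3%:R : {poly E}) != 0 by rewrite -polyC_natr polyC_eq0.
have eG : a * G1 + b * G2 + c * G3 = 0.
  by rewrite -[RHS](subrr (a ^+ 3 + b ^+ 3 + c ^+ 3)) {2}e /G1 /G2 /G3; ring.
have eG' : a^`() * G1 + b^`() * G2 + c^`() * G3 = 0.
  apply: (mulfI n3P); rewrite mulr0.
  have d3 : (3%:R : {poly E})^`() = 0 by rewrite -polyC_natr derivC.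
  have := congr1 (@deriv E) e.
  rewrite /l !exprS !expr0 !mulr1 !(derivM, derivD, derivC, d3) => /eqP.
  by rewrite -subr_eq0 => /eqP e'; rewrite -[RHS]e' /G1 /G2 /G3 /l; ring.
have cross (x x' y y' z z' Gx Gy Gz : {poly E}) : x * Gx + y * Gy + z * Gz = 0 :> {poly E} ->
    x' * Gx + y' * Gy + z' * Gz = 0 -> Gx * (z * x' - x * z') = Gy * (y * z' - z * y').
  move=> e1 e2; apply/eqP; rewrite -subr_eq0; apply/eqP.
  transitivity (z * (x' * Gx + y' * Gy + z' * Gz) - z' * (x * Gx + y * Gy + z * Gz)).
    by ring.
  by rewrite e1 e2 !mulr0 subrr.
have e12 : G1 * W2 = G2 * W1 by apply: cross eG eG'.
have e23 : G2 * W3 = G3 * W2.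
  by apply: (cross b _ c _ a _ G2 G3 G1); [rewrite -eG | rewrite -eG']; ring.
have e31 : G3 * W1 = G1 * W3.
  by apply: (cross c _ a _ b _ G3 G1 G2); [rewrite -eG | rewrite -eG']; ring.
have gradX4 (x y z Gx Gy Gz Wx Wy Wz : {poly E}) :
    Gx = x ^+ 2 - l * (y * z) -> Gy = y ^+ 2 - l * (z * x) -> Gz = z ^+ 2 - l * (x * y) ->
    Gx * Wy = Gy * Wx -> Gy * Wz = Gz * Wy -> Gz * Wx = Gx * Wz ->
    exists m : {poly E}, [/\ (1 - l ^+ 3) * x ^+ 4 * Wx = m * Gx,
      (1 - l ^+ 3) * x ^+ 4 * Wy = m * Gy & (1 - l ^+ 3) * x ^+ 4 * Wz = m * Gz].
  move=> dx dy dz exy eyz ezx; rewrite (hesse_gradient_X4 _ _ y z) -dx -dy -dz.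
  set p := _ + l * _; set q := l ^+ 2 * _; set r := l ^+ 3 * _.
  exists (p * Wx + q * Wy + r * Wz); split.
  - rewrite !mulrDl -!mulrA -exy ezx; ring.
  - rewrite !mulrDl -!mulrA exy -eyz; ring.
  - rewrite !mulrDl -!mulrA eyz -ezx; ring.
have [ma [a1 a2 a3]] := gradX4 a b c _ _ _ _ _ _ erefl erefl erefl e12 e23 e31.
have [mb [b2 b3 b1]] := gradX4 b c a _ _ _ _ _ _ erefl erefl erefl e23 e31 e12.
have [mc [c3 c1 c2]] := gradX4 c a b _ _ _ _ _ _ erefl erefl erefl e31 e12 e23.
pose M := u * ma + v * mb + w * mc.
have k0 : 1 - al ^+ 3 != 0 by rewrite subr_eq0 eq_sym.
have kE : 1 - l ^+ 3 = (1 - al ^+ 3)%:P by rewrite /l -rmorphXn -polyC1 -rmorphB.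
have comb (W G : {poly E}) : (1 - l ^+ 3) * a ^+ 4 * W = ma * G ->
    (1 - l ^+ 3) * b ^+ 4 * W = mb * G -> (1 - l ^+ 3) * c ^+ 4 * W = mc * G ->
    (1 - al ^+ 3) *: W = M * G.
  move=> ea eb ec; rewrite -mul_polyC -kE.
  rewrite /M !mulrDl -!(mulrA _ _ G) -ea -eb -ec -[LHS]mulr1 -huvw; ring.
have {a1 b1 c1}w1 := comb _ _ a1 b1 c1.
have {a2 b2 c2}w2 := comb _ _ a2 b2 c2.
have {a3 b3 c3}w3 := comb _ _ a3 b3 c3.
(* A nonzero M would bound the degree of G by that of v x v'. *)
have [M0|M0] := eqVneq M 0.
  apply/eqP; rewrite -subr_eq0 -/W3; move/eqP: w3.
  by rewrite M0 mul0r scaler_eq0 (negPf k0).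
have szG (W G : {poly E}) n : (1 - al ^+ 3) *: W = M * G -> (size W <= n)%N -> (size G <= n)%N.
  move=> eW hW; have [->|G0] := eqVneq G 0; first by rewrite size_poly0.
  have := congr1 (fun p : {poly E} => size p) eW; rewrite size_scale // size_mul //.
  move=> sW; apply: leq_trans hW; rewrite sW.
  by move: M0; rewrite -size_poly_gt0; case: (size M) => // k _; rewrite leq_addl.
pose n := (maxn (size a) (maxn (size b) (size c))).-1.
have nS : n.+1 = maxn (size a) (maxn (size b) (size c)).
  rewrite /n prednK //; case: posnP => // /eqP; rewrite -leqn0 !geq_max !leqn0 !size_poly_eq0.
  move=> /and3P[/eqP a0 /eqP b0 /eqP c0]; move/eqP: huvw.
  by rewrite a0 b0 c0 !expr0n !mulr0 !addr0 eq_sym oner_eq0.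
have ha : (size a <= n.+1)%N by rewrite nS leq_maxl.
have hb : (size b <= n.+1)%N by rewrite nS; lia.
have hc : (size c <= n.+1)%N by rewrite nS; lia.
have h1 := szG _ _ _ w1 (size_wronskian hb hc).
have h2 := szG _ _ _ w2 (size_wronskian hc ha).
have h3 := szG _ _ _ w3 (size_wronskian ha hb).
have [nE|nE|nE] : [\/ size a = n.+1, size b = n.+1 | size c = n.+1].
  have : [|| size a == n.+1, size b == n.+1 | size c == n.+1] by lia.
  by case/or3P => /eqP ?; [apply: Or31 | apply: Or32 | apply: Or33].
- by case: (size_hesse_gradient hb hc nE h1 h2 h3).
- by case: (size_hesse_gradient hc ha nE h2 h3 h1).
- by case: (size_hesse_gradient ha hb nE h3 h1 h2).
Qed.

Lemma primitive_triple a b c : [|| a != 0, b != 0 | c != 0] ->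
  exists g a1 b1 c1 u v w, [/\ g != 0, a = g * a1, b = g * b1, c = g * c1
    & u * a1 + v * b1 + w * c1 = 1].
Proof.
move=> nz; pose g := gcdp (gcdp a b) c.
have g0 : g != 0 by rewrite /g !gcdp_eq0 !negb_and -orbA.
have da : g %| a by rewrite (dvdp_trans (dvdp_gcdl _ _)) // dvdp_gcdl.
have db : g %| b by rewrite (dvdp_trans (dvdp_gcdl _ _)) // dvdp_gcdr.
have dc : g %| c by rewrite dvdp_gcdr.
have bezout p q : exists u v, u * p + v * q = gcdp p q :> {poly E}.
  have [[u v] /= /eqpP[[k1 k2] /= /andP[k10 k20] e]] := Bezoutp p q.
  exists ((k1 / k2) *: u), ((k1 / k2) *: v).
  by rewrite -!scalerAl -scalerDr mulrC -scalerA e scalerA mulVf ?scale1r.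
have [u [v e1]] := bezout a b; have [r [w e2]] := bezout (gcdp a b) c.
exists g, (a %/ g), (b %/ g), (c %/ g), (r * u), (r * v), w.
split=> //; try by rewrite mulrC divpK.
apply: (mulfI g0); rewrite mulr1 -[RHS]e2 -e1 !mulrDr.
rewrite !(mulrCA g) !(mulrC g) !divpK //; ring.
Qed.

(** A smooth plane cubic is not rational: a polynomial parametrization is a
    multiple of a constant point. Dividing by the gcd only scales the Wronskian
    by its square. *)
Lemma hesse_curve a b c :
  a ^+ 3 + b ^+ 3 + c ^+ 3 = 3%:R * al%:P * (a * b * c) -> a * b^`() = b * a^`().
Proof.
move=> e; have [nz|] := boolP [|| a != 0, b != 0 | c != 0]; last first.
  by rewrite !negb_or !negbK => /and3P[/eqP-> /eqP-> _]; rewrite !mul0r.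
have [g [a1 [b1 [c1 [u [v [w [g0 ea eb ec uvw]]]]]]]] := primitive_triple nz.
have e1 : a1 ^+ 3 + b1 ^+ 3 + c1 ^+ 3 = 3%:R * al%:P * (a1 * b1 * c1).
  apply: (mulfI (expf_neq0 3 g0)).
  transitivity (a ^+ 3 + b ^+ 3 + c ^+ 3); first by rewrite ea eb ec; ring.
  by rewrite e ea eb ec; ring.
have e2 := hesse_primitive e1 uvw.
rewrite ea eb !derivM.
transitivity (g * g^`() * a1 * b1 + g ^+ 2 * (a1 * b1^`())); first by ring.
by rewrite e2; ring.
Qed.

End HesseCurve.

(** * The exponential of a locally nilpotent derivation *)

Definition leibniz (K : fieldType) (A : comAlgType K) (D : {linear A -> A}) :=
  forall a b, D (a * b) = D a * b + a * D b.

Section Flow.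
Variables (K : fieldType) (A : comAlgType K) (D : {linear A -> A}).
Hypotheses (char0 : [pchar K] =i pred0) (leib : leibniz D).

Lemma natr_pchar0 n : (n.+1%:R : K) != 0.
Proof. by rewrite ((pcharf0P _).1 char0). Qed.

Lemma natr_mulIf n : injective (fun a : A => a *+ n.+1).
Proof.
move=> a b /(congr1 ( *:%R n.+1%:R^-1)).
by rewrite -!scaler_nat !scalerA mulVf ?natr_pchar0 // !scale1r.
Qed.

Lemma coef_mapD (p : {poly A}) i : (map_poly D p)`_i = D p`_i.
Proof. by rewrite coef_map_id0 ?raddf0. Qed.

(** The differential equation p' = D p on coefficients has at most one solution
    with given value at 0; this is what makes the exponential of D
    additive and multiplicative. *)
Lemma flow_uniq (p q : {poly A}) : p^`() = map_poly D p -> q^`() = map_poly D q ->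
  p`_0 = q`_0 -> p = q.
Proof.
move=> ep eq e0; apply/polyP; elim=> // n IH.
apply: (@natr_mulIf n); rewrite /= -!coef_deriv ep eq.
by rewrite !coef_mapD IH.
Qed.

Lemma map_poly_leibniz (p q : {poly A}) :
  map_poly D (p * q) = map_poly D p * q + p * map_poly D q.
Proof.
apply/polyP => n; rewrite coefD coef_mapD !coefM raddf_sum -big_split.
by apply: eq_bigr => i _; rewrite /= leib !coef_mapD.
Qed.

Lemma derivation1 : D 1 = 0.
Proof. by apply: (@addrI _ (D 1)); rewrite addr0 -{3}[1]mulr1 leib mulr1 mul1r. Qed.

Hypothesis nilp : locally_nilpotent D.

(** The map psi is the exponential a |-> \sum_i (D^i a / i!) t^i, a polynomial
    in t because D is locally nilpotent. The degree of psi a in t is the usual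
    degree function of D. *)
Lemma flow_exists : exists psi : {rmorphism A -> {poly A}},
  [/\ forall a, (psi a)`_0 = a, forall a, (psi a)^`() = psi (D a)
    & forall a, D a = 0 -> psi a = a%:P].
Proof.
have nilpb a : exists m, iter m D a == 0 by have [m e] := nilp a; exists m; apply/eqP.
have iter0 m : iter m D 0 = 0 by elim: m => //= m ->; rewrite raddf0.
pose f a : {poly A} := \poly_(i < ex_minn (nilpb a)) (i`!%:R^-1 *: iter i D a).
have fE a i : (f a)`_i = i`!%:R^-1 *: iter i D a.
  rewrite coef_poly; case: ex_minnP => m /eqP em _; case: ltnP => // lmi.
  by rewrite -(subnK lmi) iterD em iter0 scaler0.
have f0 a : (f a)`_0 = a by rewrite fE fact0 invr1 scale1r.
have fD a : (f a)^`() = f (D a).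
  apply/polyP => i; rewrite coef_deriv !fE -scaler_nat scalerA factS natrM -iterSr.
  by rewrite invfM mulrA mulfV ?mul1r ?natr_pchar0.
have fmap a : map_poly D (f a) = f (D a).
  by apply/polyP => i; rewrite coef_mapD !fE linearZ -iterS iterSr.
have ff a : (f a)^`() = map_poly D (f a) by rewrite fD fmap.
have fB : zmod_morphism f.
  move=> a b; apply: flow_uniq => //; last by rewrite coefB !f0.
  by rewrite derivB raddfB !ff.
have fM : monoid_morphism f.
  split=> [|a b]; apply: flow_uniq => //; rewrite ?f0 ?coefC //.
  - by rewrite derivC map_polyC /= derivation1.
  - by rewrite derivM map_poly_leibniz !ff.
  - by rewrite coefM big_ord1 !f0.
pose fA := GRing.isZmodMorphism.Build A {poly A} f fB.
pose fR := GRing.isMonoidMorphism.Build A {poly A} f fM.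
pose psi : {rmorphism A -> {poly A}} := HB.pack f fA fR.
exists psi; split=> // a Da; apply: flow_uniq; rewrite ?ff ?f0 ?coefC //.
by rewrite derivC map_polyC /= Da.
Qed.

End Flow.

(** * Polynomial rings: substitutions and derivations *)

Section MPoly.
Variables (n : nat) (K : fieldType).
Local Notation A := {mpoly K[n]}.

Lemma mpoly_gen_ind (P : A -> Prop) :
  (forall c, P c%:MP) -> (forall i, P 'X_i) ->
  (forall p q, P p -> P q -> P (p + q)) -> (forall p q, P p -> P q -> P (p * q)) ->
  forall p, P p.
Proof.
move=> PC PX PD PM; elim/mpolyind => [|c m p _ _ IH]; first by rewrite -mpolyC0.
apply: PD IH; rewrite -mul_mpolyC; apply: (PM) => //.
rewrite mpolyXE_id; apply: (big_ind P) => [|p1 p2|i _]; [by rewrite -mpolyC1 | by move=> ? ?; apply: PM |].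
by elim: (m i) => [|k IH]; rewrite ?expr0 -?mpolyC1 // exprS; apply: (PM).
Qed.

Lemma mpoly_morph_ext (S : nzRingType) (f g : {rmorphism A -> S}) :
  (forall c, f c%:MP = g c%:MP) -> (forall i, f 'X_i = g 'X_i) -> f =1 g.
Proof.
move=> eC eX; elim/mpoly_gen_ind => // p q ep eq; first by rewrite !rmorphD ep eq.
by rewrite !rmorphM ep eq.
Qed.

(** Two substitutions that agree modulo p on the variables agree modulo p
    everywhere; here one of them is the identity. *)
Lemma subst_congr (f : {rmorphism A -> A}) (p : A) :
  (forall c, f c%:MP = c%:MP) -> (forall i, exists b, 'X_i = f 'X_i + p * b) ->
  forall a, exists b, a = f a + p * b.
Proof.
move=> eC eX; elim/mpoly_gen_ind => // [c|a b [a' ea] [b' eb]|a b [a' ea] [b' eb]].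
- by exists 0; rewrite mulr0 addr0.
- by exists (a' + b'); rewrite {1}ea {1}eb rmorphD; ring.
- by exists (f a * b' + a' * f b + p * a' * b'); rewrite {1}ea {1}eb rmorphM; ring.
Qed.

Lemma mpolyX_neq0 (i : 'I_n) : 'X_i != 0 :> A.
Proof. by rewrite -msize_poly_eq0 msizeX. Qed.

Definition subst (h : 'I_n -> A) : A -> A := mmap (@mpolyC n K) h.
HB.instance Definition _ (h : 'I_n -> A) := GRing.RMorphism.on (subst h).

Lemma substC h c : subst h c%:MP = c%:MP.
Proof. exact: mmapC. Qed.

Lemma substX h i : subst h 'X_i = h i.
Proof. by rewrite /subst mmapX mmap1U. Qed.

Lemma mderivXi (i j : 'I_n) : ('X_i : A)^`M(j) = (i == j)%:R.
Proof.
rewrite mderivX mnm1E; case: eqP => [->|_]; last by rewrite scale0r.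
by rewrite scale1r -{1}[U_(j)%MM]add0m addmK mpolyX0.
Qed.

Section VectorField.
Variable f : 'I_n -> A.

Definition vfield (a : A) := \sum_i f i * a^`M(i).

Lemma vfield_linear : linear vfield.
Proof.
move=> k a b; rewrite /vfield scaler_sumr -big_split; apply: eq_bigr => i _ /=.
by rewrite mderivD mderivZ mulrDr scalerAr.
Qed.

HB.instance Definition _ := GRing.isLinear.Build K A A _ vfield vfield_linear.

Lemma vfieldM a b : vfield (a * b) = vfield a * b + a * vfield b.
Proof.
rewrite /vfield mulr_suml mulr_sumr -big_split; apply: eq_bigr => i _ /=.
by rewrite mderivM; ring.
Qed.

Lemma vfieldXi i : vfield 'X_i = f i.
Proof.
rewrite /vfield (bigD1 i) //= mderivXi eqxx mulr1 big1 ?addr0 // => j.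
by rewrite mderivXi eq_sym => /negPf->; rewrite mulr0.
Qed.

End VectorField.

Lemma derivationC (D : {linear A -> A}) : leibniz D -> forall k, D k%:MP = 0.
Proof.
by move=> leib k; rewrite -[k%:MP]mulr1 mul_mpolyC linearZ /= derivation1 // scaler0.
Qed.

Lemma derivationE (D : {linear A -> A}) :
  leibniz D -> forall a, D a = vfield (fun i => D 'X_i) a.
Proof.
move=> leib.
elim/mpoly_gen_ind => [c|i|p q ep eq|p q ep eq].
- by rewrite derivationC // /vfield big1 // => i _; rewrite mderivC mulr0.
- by rewrite vfieldXi.
- by rewrite !raddfD /= ep eq.
- by rewrite leib vfieldM ep eq.
Qed.

End MPoly.

(** * A cubic over a rational function field without roots *)

Lemma fraction_quotient (R : idomainType) (r : {fraction R}) :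
  exists n d, d != 0 /\ r = n%:F / d%:F.
Proof.
elim/quotW: r => x; exists (\n_x), (\d_x).
have dx := denom_ratioP x; split=> //.
have dF : (\d_x)%:F != 0 by rewrite tofrac_eq0.
apply: (mulIf dF); rewrite divfK //.
unlock FracField.tofrac.
rewrite -[_ * _]/(FracField.mul _ _) -FracField.pi_mul.
apply/eqmodP; rewrite /FracField.mulf !numden_Ratio ?oner_neq0 ?mulr1 //=.
by rewrite FracField.equivfE !numden_Ratio ?oner_neq0 ?mulr1 // mulrC.
Qed.

(** By degrees, P would be linear, say a + b 'X. Comparing coefficients,
    a ^+ 3 = - X ^+ 3, b ^+ 3 = -1 and a * b = al * X, whose cube is
    X ^+ 3 = al ^+ 3 * X ^+ 3. *)
Lemma no_root_poly (k : fieldType) (al X : k) (P : {poly k}) :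
  (3%:R : k) != 0 -> X != 0 -> al ^+ 3 != 1 ->
  P ^+ 3 - (3%:R * al * X)%:P * 'X * P + ((X ^+ 3)%:P + 'X^3) <> 0.
Proof.
move=> n3 X0 al3 e.
have sP : (size P <= 2)%N.
  rewrite leqNgt; apply/negP => sP.
  have s3 : (size (P ^+ 3)).-1 = ((size P).-1 * 3)%N := size_exp P 3.
  have e' : P ^+ 3 = (3%:R * al * X) *: (P * 'X) + - ((X ^+ 3)%:P + 'X^3).
    apply/eqP; rewrite -subr_eq0 -mul_polyC -[X in _ == X]e; apply/eqP; ring.
  have : (size (P ^+ 3) <= (size P).+1)%N.
    rewrite e' (leq_trans (size_polyD _ _)) // geq_max; apply/andP; split.
      by rewrite (leq_trans (size_scale_leq _ _)) // (leq_trans (size_polyMleq _ _)) // size_polyX addn2.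
    rewrite size_polyN (leq_trans (size_polyD _ _)) // geq_max size_polyXn.
    by rewrite (leq_trans (size_polyC_leq1 _)) //.
  by move: s3 sP; case: (size P) => [|[|[|m]]] // s3 _; lia.
have PE : P = (P`_0)%:P + (P`_1)%:P * 'X.
  apply/polyP => -[|[|i]]; rewrite !coefE /= ?mulr0 ?mulr1 ?addr0 ?add0r //.
  by rewrite nth_default // (leq_trans sP).
move: e; rewrite PE; set a := P`_0; set b := P`_1 => e.
have {}e : (a ^+ 3 + X ^+ 3)%:P + (3%:R * a ^+ 2 * b - 3%:R * al * X * a)%:P * 'X
   + (3%:R * a * b ^+ 2 - 3%:R * al * X * b)%:P * 'X^2 + (b ^+ 3 + 1)%:P * 'X^3 = 0.
  by rewrite -[RHS]e !(rmorphD, rmorphB, rmorphM, rmorphXn) /=; ring.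
have c0 : a ^+ 3 = - X ^+ 3.
  have := congr1 (fun p : {poly k} => p`_0) e; rewrite !coefE /= !mulr0 !addr0 => /eqP.
  by rewrite addr_eq0 => /eqP.
have c3 : b ^+ 3 = -1.
  have := congr1 (fun p : {poly k} => p`_3) e; rewrite !coefE /= !mulr0 ?mulr1 !add0r => /eqP.
  by rewrite addr_eq0 => /eqP.
have b0 : b != 0 by apply: contra_eq_neq c3 => ->; rewrite expr0n /= eq_sym oppr_eq0 oner_eq0.
have c2 : a * b = al * X.
  have := congr1 (fun p : {poly k} => p`_2) e; rewrite !coefE /= !mulr0 ?mulr1 !add0r addr0.
  move=> /eqP; rewrite subr_eq0 => /eqP h; apply: (mulfI n3); apply: (mulIf b0).
  by transitivity (3%:R * a * b ^+ 2); [ring | rewrite h; ring].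
move/negP: al3; apply; apply/eqP; apply: (mulIf (expf_neq0 3 X0)).
by rewrite -exprMn -c2 exprMn c0 c3 mulrN1 opprK mul1r.
Qed.

Lemma clear_denominators (F : fieldType) (p q g B C : F) : q != 0 -> g != 0 ->
  q ^+ 3 * ((p * g / (q * g)) ^+ 3 - B * (p * g / (q * g)) + C) =
  p ^+ 3 - B * p * q ^+ 2 + C * q ^+ 3.
Proof. by move=> q0 g0; field; rewrite q0 g0. Qed.

(** The rational root theorem: in lowest terms the denominator divides the cube
    of the numerator, so it is constant. *)
Lemma integral_root (k : fieldType) (B C : {poly k}) (r : {fraction {poly k}}) :
  r ^+ 3 - B%:F * r + C%:F = 0 -> exists P, P ^+ 3 - B * P + C = 0.
Proof.
have [n [d [d0 ->]]] := fraction_quotient r.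
pose g := gcdp n d; have g0 : g != 0 by rewrite gcdp_eq0 negb_and d0 orbT.
have cop : coprimep (n %/ g) (d %/ g) by rewrite coprimep_div_gcd // d0 orbT.
have nE : n = (n %/ g) * g by rewrite divpK ?dvdp_gcdl.
have dE : d = (d %/ g) * g by rewrite divpK ?dvdp_gcdr.
clearbody g; move: nE dE cop; move: (n %/ g) (d %/ g) => p q nE dE cop e.
have q0 : q != 0 by move: d0; rewrite dE mulf_eq0 negb_or => /andP[].
have {}e : p ^+ 3 - B * p * q ^+ 2 + C * q ^+ 3 = 0.
  apply/eqP; rewrite -tofrac_eq0; apply/eqP.
  have gF : g%:F != 0 by rewrite tofrac_eq0.
  have qF : q%:F != 0 by rewrite tofrac_eq0.
  rewrite !(tofracD, tofracN, tofracM, tofracXn) -(clear_denominators _ _ _ qF gF).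
  by rewrite -!tofracM -nE -dE e mulr0.
have : q %| p ^+ 3.
  have -> : p ^+ 3 = (B * p * q - C * q ^+ 2) * q.
    by apply/eqP; rewrite -subr_eq0 -[X in _ == X]e; apply/eqP; ring.
  exact: dvdp_mull.
rewrite -[p ^+ 3]mulr1 Gauss_dvdpr ?coprimep_expr 1?coprimep_sym // => q1.
have /size_poly1P[u u0 qu] : size q == 1%N by rewrite -dvdp1.
have uP : u%:P != 0 :> {poly k} by rewrite polyC_eq0.
exists (u^-1%:P * p); apply: (mulfI (expf_neq0 3 uP)); rewrite mulr0 -[RHS]e qu.
have uV : u%:P * u^-1%:P = 1 :> {poly k} by rewrite -polyCM mulfV.
transitivity ((u%:P * u^-1%:P) ^+ 3 * p ^+ 3 - (u%:P * u^-1%:P) * B * p * u%:P ^+ 2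
  + C * u%:P ^+ 3); first by ring.
by rewrite uV; ring.
Qed.

(** * The generic point of the Hesse cubic *)

Lemma horner_depressed (R : comNzRingType) (b c r : R) :
  ('X^3 - b%:P * 'X + c%:P).[r] = r ^+ 3 - b * r + c.
Proof. by rewrite !hornerE. Qed.

Section GenericPoint.
Variable (K : fieldType).
Local Notation A := {mpoly K[3]}.
Local Notation T := {poly {poly {poly K}}}.

(** Three times the Casimir, which clears its denominators. *)
Definition hesse_cubic (al : K) : A :=
  vx ^+ 3 + vy ^+ 3 + vz ^+ 3 - (3%:R * al)%:MP * (vx * vy * vz).

(** The innermost ring is K[x], the middle variable is y and the outer one is z:
    the cubic is then monic in the outer variable. *)
Definition iterated_var (i : 'I_3) : T := nth 0 [:: 'X%:P%:P; 'X%:P; 'X] i.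

Definition to_iterated : A -> T :=
  mmap (polyC \o polyC \o polyC) iterated_var.
HB.instance Definition _ := GRing.RMorphism.on to_iterated.

Lemma to_iteratedC c : to_iterated c%:MP = c%:P%:P%:P.
Proof. exact: mmapC. Qed.

Lemma to_iteratedX i : to_iterated 'X_i = iterated_var i.
Proof. by rewrite /to_iterated mmapX mmap1U. Qed.

Definition of_iterated : T -> A :=
  horner_eval vz \o map_poly (horner_eval vy \o map_poly (horner_eval vx \o map_poly (@mpolyC 3 K))).
HB.instance Definition _ := GRing.RMorphism.on of_iterated.

Lemma to_iteratedK : cancel to_iterated of_iterated.
Proof.
move=> a; rewrite -[of_iterated _]/((of_iterated \o to_iterated) a) -[RHS]/(idfun a).
apply: mpoly_morph_ext a => [c|i] /=.
  rewrite to_iteratedC /of_iterated /=.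
  by do 3!rewrite map_polyC /= horner_evalE hornerC.
rewrite to_iteratedX /of_iterated /iterated_var /=.
case: i => [[|[|[|i]]] Hi] //=;
 do 3?rewrite ?map_polyC ?map_polyX /= horner_evalE ?hornerC ?hornerX.
- by congr 'X_ _; apply: val_inj.
- by congr 'X_ _; apply: val_inj.
- by congr 'X_ _; apply: val_inj.
Qed.

Lemma to_iterated_hesse al : to_iterated (hesse_cubic al) =
  'X^3 - ((3%:R * al)%:P%:P * 'X%:P * 'X)%:P * 'X + ('X%:P ^+ 3 + 'X^3)%:P.
Proof.
rewrite /hesse_cubic !(rmorphB, rmorphD, rmorphM, rmorphXn) /= to_iteratedC !to_iteratedX /iterated_var /=.
by rewrite to_iteratedC !polyC1; ring.
Qed.

Lemma size_to_iterated_hesse al : size (to_iterated (hesse_cubic al)) = 4%N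
  /\ to_iterated (hesse_cubic al) \is monic.
Proof.
rewrite to_iterated_hesse.
set B : {poly {poly K}} := _ * 'X; set C : {poly {poly K}} := _ + 'X^3.
have slow : (size (- (B%:P * 'X) + C%:P)%R < size ('X^3 : T))%N.
  rewrite size_polyXn ltnS (leq_trans (size_polyD _ _)) // geq_max size_polyN.
  rewrite (leq_trans (size_polyC_leq1 _)) // andbT mul_polyC.
  by rewrite (leq_trans (size_scale_leq _ _)) // size_polyX.
by rewrite -addrA monicE size_polyDl // lead_coefDl // size_polyXn lead_coefXn.
Qed.

(** The morphism sends (x, y, z) to the generic point of the cubic cone: L is
    obtained from K(x)(y) by adjoining a root z of the cubic, which has no root
    in K(x)(y) and hence is irreducible. Since the cubic is monic in z, division
    by it brings any polynomial to degree at most 2 in z, where the morphism is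
    injective. *)
Lemma generic_point (al : K) : (3%:R : K) != 0 -> al ^+ 3 != 1 ->
  exists (L : fieldType) (h : {rmorphism A -> L}),
  forall a, h a = 0 <-> exists q, a = hesse_cubic al * q.
Proof.
move=> n3 al3.
pose k := {fraction {poly K}}.
pose F := {fraction {poly k}}.
pose iK : {rmorphism {poly K} -> k} := @FracField.tofrac {poly K}.
pose iF : {rmorphism {poly k} -> F} := @FracField.tofrac {poly k}.
pose j : {rmorphism {poly {poly K}} -> F} := iF \o map_poly iK.
have iK_inj : injective iK by move=> p q /eqP; rewrite tofrac_eq => /eqP.
have iF_inj : injective iF by move=> p q /eqP; rewrite tofrac_eq => /eqP.
have j_inj : injective j by move=> p q /iF_inj /(map_inj_poly iK_inj (rmorph0 _)).
pose c := to_iterated (hesse_cubic al).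
pose B : {poly {poly K}} := (3%:R * al)%:P%:P * 'X%:P * 'X.
pose C : {poly {poly K}} := 'X%:P ^+ 3 + 'X^3.
have cE : c = 'X^3 - B%:P * 'X + C%:P := to_iterated_hesse al.
have [sc cm] := size_to_iterated_hesse al; rewrite -/c in sc cm.
pose p := map_poly j c.
have pE : p = 'X^3 - (j B)%:P * 'X + (j C)%:P.
  by rewrite /p cE raddfD raddfB /= map_polyXn rmorphM /= !map_polyC map_polyX.
have sp : size p = 4%N by rewrite size_map_inj_poly ?rmorph0.
have irr : irreducible_poly p.
  apply: cubic_irreducible => [|r]; first by rewrite sp.
  apply/rootP => e.
  have i3 : 3%:R * iK al%:P = iK (3%:R * al)%:P by rewrite polyCM rmorphM polyC_natr rmorph_nat.
  have [P] : exists P, P ^+ 3 - (3%:R * iK al%:P * iK 'X)%:P * 'X * P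
      + ((iK 'X ^+ 3)%:P + 'X^3) = 0.
    apply: (@integral_root k _ _ r).
    rewrite pE horner_depressed in e.
    apply: etrans e.
    congr (_ - _ * _ + _); rewrite /j /= /B /C; congr FracField.tofrac.
      by rewrite i3 -(rmorphM iK) -polyCM [RHS]rmorphM /= map_polyC map_polyX.
    by rewrite -polyC_exp [RHS]rmorphD /= map_polyXn map_polyC -rmorphXn.
  apply: no_root_poly.
  - by rewrite -(rmorph_nat iK) -polyC_natr tofrac_eq0 polyC_eq0.
  - by rewrite tofrac_eq0 polyX_eq0.
  - by rewrite -rmorphXn -(rmorph1 iK) (inj_eq iK_inj) -polyC1 -rmorphXn (inj_eq (@polyC_inj _)).
have [L _ [z rz _]] := irredp_FAdjoin irr.
pose h0 : {rmorphism T -> L} := horner_eval z \o map_poly (in_alg L \o j).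
exists L, (h0 \o to_iterated) => a; split=> [h0a|[q ->]]; last first.
  have hc : h0 c = 0.
    by rewrite /h0 /= horner_evalE map_poly_comp; apply/eqP.
  by rewrite -[LHS]/(h0 (to_iterated (hesse_cubic al * q))) rmorphM (rmorphM h0) -/c hc mul0r.
exists (of_iterated (rdivp (to_iterated a) c)).
rewrite -[LHS]to_iteratedK -[hesse_cubic al]to_iteratedK -rmorphM; congr of_iterated.
rewrite {1}(rdivp_eq cm (to_iterated a)) mulrC -/c; set r := rmodp _ _.
suff -> : r = 0 by rewrite addr0.
have sr : (size r < 4)%N by rewrite -sc ltn_rmodp -size_poly_gt0 sc.
have hr : h0 r = 0.
  have := rdivp_eq cm (to_iterated a); rewrite -/r => /(congr1 h0).
  have hc : h0 c = 0.
    by rewrite /h0 /= horner_evalE map_poly_comp; apply/eqP.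
  by rewrite rmorphD rmorphM hc mulr0 add0r => <-.
pose r1 := map_poly j r.
have rz1 : (map_poly (in_alg L) r1).[z] = 0 by rewrite -hr /h0 /= horner_evalE map_poly_comp.
have sr1 : (size r1 < size p)%N by rewrite sp size_map_inj_poly ?rmorph0.
suff r10 : r1 = 0.
  by apply: (map_inj_poly j_inj (rmorph0 j)); rewrite rmorph0 -/r1 r10.
apply/eqP/negPn/negP => r10; suff : coprimep p r1.
  by rewrite -(coprimep_map (in_alg L)) => /coprimep_root /(_ rz); rewrite rz1 eqxx.
rewrite irreducible_poly_coprime //; apply: contraL sr1 => /(dvdp_leq r10).
by rewrite -leqNgt.
Qed.
End GenericPoint.

(** * Divisibility by the smooth cubic *)

Section KillVariable.
Variables (n : nat) (K : fieldType).
Local Notation A := {mpoly K[n]}.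

Definition kill (i : 'I_n) : A -> A :=
  subst (fun k => if k == i then 0 else 'X_k).
HB.instance Definition _ (i : 'I_n) := GRing.RMorphism.on (kill i).

Lemma killX i k : kill i 'X_k = if k == i then 0 else 'X_k.
Proof. exact: substX. Qed.

Lemma kill_congr i a : exists b, a = kill i a + 'X_i * b.
Proof.
apply: (subst_congr (f := kill i)) => [c|k]; first exact: substC.
exists (k == i)%:R; rewrite /= killX; case: eqP => [->|_]; rewrite ?mulr1 ?mulr0 ?add0r ?addr0 //.
Qed.

(** When c stays nonzero at 'X_i = 'X_j = 0, the sequence ('X_i, 'X_j) is regular
    modulo c. Setting 'X_i = 0, and then 'X_j = 0, shows that q becomes divisible
    by 'X_j. *)
Lemma regular_pair (i j : 'I_n) (c f g q : A) : i != j ->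
  kill j (kill i c) != 0 -> 'X_j * f - 'X_i * g = c * q ->
  exists e u, f = 'X_i * e + c * u.
Proof.
move=> ij cn0 e.
have ei : 'X_j * kill i f = kill i c * kill i q.
  rewrite -rmorphM -e rmorphB !rmorphM /= !killX eqxx mul0r subr0.
  by rewrite eq_sym (negPf ij).
have [q' qE] := kill_congr j (kill i q).
have qj0 : kill j (kill i q) = 0.
  apply: (mulfI cn0); rewrite mulr0 -rmorphM -ei rmorphM /= killX eqxx mul0r //.
rewrite qj0 add0r in qE.
have ef : kill i f = kill i c * q'.
  by apply: (mulfI (mpolyX_neq0 K j)); rewrite ei qE; ring.
have [f' fE] := kill_congr i f; have [c' cE] := kill_congr i c.
exists (f' - c' * q'), q'; rewrite {1}fE ef {2}cE; ring.
Qed.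

End KillVariable.

Section Smooth.
Variables (K : fieldType) (al : K).
Hypotheses (char0 : [pchar K] =i pred0).
Local Notation A := {mpoly K[3]}.
Let c := hesse_cubic al.

Lemma I3P (i : 'I_3) : [\/ i = 0, i = 1 | i = 2].
Proof.
by case: i => [[|[|[|]]]] // Hi; [apply: Or31 | apply: Or32 | apply: Or33]; apply: val_inj.
Qed.

Lemma hesse_morph (S : comNzRingType) (g : {rmorphism A -> S}) :
  g c = g vx ^+ 3 + g vy ^+ 3 + g vz ^+ 3 - g (3%:R * al)%:MP * (g vx * g vy * g vz).
Proof.
by rewrite /c /hesse_cubic rmorphB !rmorphD !rmorphXn [g (_%:MP * _)]rmorphM !(rmorphM g).
Qed.

(** Composing the exponential of D with the generic point of the cubic c
    gives a polynomial curve on c = 0, because D c = 0. By [hesse_curve] it is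
    a multiple of a constant point, so that x Dy - y Dx is divisible by c. As
    (x, y) is regular modulo c, Dx is a multiple of x modulo c. On the curve Dx
    is the derivative of the coordinate x, hence of smaller degree than x, so it
    vanishes. The other coordinates follow by rotation. *)
Lemma smooth_step (D : {linear A -> A}) : al ^+ 3 != 1 ->
  leibniz D -> locally_nilpotent D ->
  D c = 0 -> forall i, exists q, D 'X_i = c * q.
Proof.
move=> al3 leib nilp Dc.
have n3 : (3%:R : K) != 0 by exact: natr_pchar0.
have [psi [psi0 psiD psiC]] := flow_exists char0 leib nilp.
have [L [h hc]] := generic_point n3 al3.
pose phi : {rmorphism A -> {poly L}} := map_poly h \o psi.
have phi0 a : (phi a)`_0 = h a by rewrite /phi /= coef_map psi0.
have phiD a : (phi a)^`() = phi (D a) by rewrite /phi /= deriv_map psiD.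
have phiC a : D a = 0 -> phi a = (h a)%:P by move=> Da; rewrite /phi /= psiC // map_polyC.
pose hK : {rmorphism K -> L} := h \o @mpolyC 3 K.
have n3L : (3%:R : L) != 0 by rewrite -(rmorph_nat hK) fmorph_eq0.
have alL : hK al ^+ 3 != 1 by rewrite -rmorphXn fmorph_eq1.
have curve : phi vx ^+ 3 + phi vy ^+ 3 + phi vz ^+ 3 = 3%:R * (hK al)%:P * (phi vx * phi vy * phi vz).
  have : phi c = 0 by rewrite phiC // (_ : h c = 0) //; apply/hc; exists 1; rewrite mulr1.
  rewrite hesse_morph.
  rewrite (phiC _%:MP) ?derivationC // -[h _]/(hK _) rmorphM rmorph_nat polyCM polyC_natr.
  by move=> /eqP; rewrite subr_eq0 => /eqP.
have pairs p q : phi p * (phi q)^`() = phi q * (phi p)^`() -> exists r, q * D p - p * D q = c * r.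
  rewrite !phiD => /(congr1 (fun s : {poly L} => s`_0)); rewrite -!rmorphM !phi0 => e.
  by apply/hc; rewrite rmorphB e subrr.
have step (i j : 'I_3) : i != j -> kill j (kill i c) != 0 ->
    phi 'X_i * (phi 'X_j)^`() = phi 'X_j * (phi 'X_i)^`() -> exists q, D 'X_i = c * q.
  move=> ij cn0 /pairs [r er]; have [e [u Du]] := regular_pair ij cn0 er.
  have d0 : (phi 'X_i)^`() = 0.
    have [->|x0] := eqVneq (phi 'X_i) 0; first by rewrite deriv0.
    have := lt_size_deriv x0.
    have -> : (phi 'X_i)^`() = phi 'X_i * phi e.
      rewrite phiD Du rmorphD !rmorphM (phiC c) // (_ : h c = 0) ?mul0r ?addr0 //.
      by apply/hc; exists 1; rewrite mulr1.
    have [->|e0] := eqVneq (phi e) 0; first by rewrite mulr0.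
    rewrite size_mul // ltnNge; case/negP; rewrite -(prednK (_ : 0 < size (phi e))%N) ?size_poly_gt0 //.
    by rewrite addnS leq_addr.
  by apply/hc; rewrite -phi0 -phiD d0 coef0.
have X3 (i : 'I_3) : 'X_i ^+ 3 != 0 :> A by rewrite expf_neq0 // mpolyX_neq0.
have kills (i j : 'I_3) : i != j -> exists k : 'I_3, kill j (kill i c) = 'X_k ^+ 3.
  have kX m : kill j (kill i 'X_m) = if (m == i) || (m == j) then 0 else 'X_m.
    by rewrite killX; case: eqP => _; rewrite ?rmorph0 // killX.
  rewrite -[kill j _]/((kill j \o kill i) c) hesse_morph /= !kX.
  by have [->|->|->] := I3P i; have [->|->|->] := I3P j => // _;
    [exists 2 | exists 1 | exists 2 | exists 0 | exists 1 | exists 0];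
    rewrite /= ?(mulr0, mul0r, subr0, add0r, addr0) ?expr0n /= ?(mulr0, mul0r, subr0, add0r, addr0).
have cn0 (i j : 'I_3) : i != j -> kill j (kill i c) != 0.
  by move=> /kills[k ->].
move=> i; have [->|->|->] := I3P i.
- by apply: (step 0 1); rewrite ?cn0 //; apply: hesse_curve curve.
- apply: (step 1 2); rewrite ?cn0 //; apply: (hesse_curve n3L alL (c := phi vx)).
  by rewrite -/vy -/vz addrC addrA curve; ring.
- apply: (step 2 0); rewrite ?cn0 //; apply: (hesse_curve n3L alL (c := phi vy)).
  by rewrite -/vx -/vz -addrA addrC curve; ring.
Qed.

End Smooth.

Section Cases.
Variables (K : fieldType) (al : K).
Hypotheses (char0 : [pchar K] =i pred0).
Local Notation A := {mpoly K[3]}.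
Implicit Type D : {linear A -> A}.
Local Notation c := (hesse_cubic al).

Lemma hesse_neq0 : c != 0.
Proof.
apply/eqP => c0; have [+ _] := size_to_iterated_hesse al.
by rewrite c0 rmorph0 size_poly0.
Qed.

(** By [smooth_step], D = c D1 where D1 is again a derivation. It kills c, and
    D^n = c^n D1^n then shows that it is locally nilpotent, so the
    argument repeats. *)
Lemma smooth_divisible N D : al ^+ 3 != 1 ->
  leibniz D -> locally_nilpotent D ->
  D c = 0 -> forall i, exists q, D 'X_i = c ^+ N * q.
Proof.
move=> al3; elim: N D => [|N IH] D leib nilp Dc.
  by move=> i; exists (D 'X_i); rewrite mul1r.
have /fin_all_exists[f fE] := smooth_step char0 al3 leib nilp Dc.
pose D1 : {linear A -> A} := vfield f.
have DD1 a : D a = c * D1 a.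
  rewrite (derivationE leib) /D1 /= /vfield mulr_sumr.
  by apply: eq_bigr => i _; rewrite fE mulrA.
have leib1 : forall a b, D1 (a * b) = D1 a * b + a * D1 b := vfieldM f.
have D1c : D1 c = 0 by apply: (mulfI hesse_neq0); rewrite -DD1 Dc mulr0.
have D1cn n a : D1 (c ^+ n * a) = c ^+ n * D1 a.
  elim: n => [|n IHn]; first by rewrite !mul1r.
  by rewrite exprS -!mulrA leib1 D1c mul0r add0r IHn.
have iterE n a : iter n D a = c ^+ n * iter n D1 a.
  by elim: n => [|n IHn] /=; rewrite ?mul1r // IHn DD1 D1cn exprS mulrA.
have nilp1 : locally_nilpotent D1.
  move=> a; have [n Dn] := nilp a; exists n.
  by apply: (mulfI (expf_neq0 n hesse_neq0)); rewrite -iterE Dn mulr0.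
move=> i; have [q qE] := IH D1 leib1 nilp1 D1c i.
by exists q; rewrite DD1 qE exprS mulrA.
Qed.

Lemma smooth_case D : al ^+ 3 != 1 ->
  leibniz D -> locally_nilpotent D ->
  D c = 0 -> forall i, D 'X_i = 0.
Proof.
move=> al3 leib nilp Dc i; apply/eqP/negPn/negP => Di0.
pose N := size (to_iterated (D 'X_i)).
have [q qE] := smooth_divisible N al3 leib nilp Dc i.
have nz (a : A) : a != 0 -> to_iterated a != 0 by apply: contra_neq => e; rewrite -[a]to_iteratedK e rmorph0.
have q0 : q != 0 by apply: contraNneq Di0 => q0; rewrite qE q0 mulr0.
have [sc _] := size_to_iterated_hesse al.
have sN := size_exp (to_iterated c) N; rewrite sc /= in sN.
have : N = (size (to_iterated c ^+ N) + size (to_iterated q)).-1.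
  by rewrite {1}/N qE rmorphM rmorphXn size_mul ?expf_neq0 ?nz ?hesse_neq0.
have : (0 < size (to_iterated c ^+ N))%N by rewrite size_poly_gt0 expf_neq0 ?nz ?hesse_neq0.
have := nz _ q0; rewrite -size_poly_gt0.
move: (size (to_iterated q)) (size (to_iterated c ^+ N)) sN; clearbody N => m k sN.
by lia.
Qed.

End Cases.

(** * The nodal case *)

Section Nodal.
Variables (K : fieldType).
Hypotheses (char0 : [pchar K] =i pred0).
Local Notation A := {mpoly K[3]}.
Implicit Type D : {linear A -> A}.

(** The exponential of D sends a * b to a constant polynomial in t, so that
    both factors have degree 0 in t. *)
Lemma factorially_closed D a b :
  leibniz D -> locally_nilpotent D ->
  a * b != 0 -> D (a * b) = 0 -> D a = 0.
Proof.
move=> leib nilp; rewrite mulf_eq0 negb_or => /andP[a0 b0] Dab.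
have [psi [psi0 psiD psiC]] := flow_exists char0 leib nilp.
have nz u : u != 0 -> psi u != 0.
  by apply: contraNneq => u0; rewrite -(psi0 u) u0 coef0.
have := congr1 (fun p : {poly A} => size p) (psiC _ Dab).
rewrite rmorphM size_mul ?nz // size_polyC mulf_neq0 //= => sz.
have sa : (size (psi a) <= 1)%N.
  have := nz _ a0; have := nz _ b0; rewrite -!size_poly_gt0.
  by move: (size (psi a)) (size (psi b)) sz => m n; lia.
by rewrite -[LHS]psi0 -psiD (size1_polyC sa) derivC coef0.
Qed.

(** The kernels of f and g are the ideals of a and b, which are therefore primes,
    and neither divides the other. Differentiating, a Da = -3 b Db, so b divides
    Da and a divides Db. Were Da and Db nonzero, the degree function of D, which
    D strictly decreases, would give deg b < deg a < deg b. *)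
Lemma derivation_sum_squares D (a b : A) (f g : {rmorphism A -> A}) :
  leibniz D -> locally_nilpotent D ->
  (forall u, exists r, u = f u + a * r) -> (forall u, exists r, u = g u + b * r) ->
  f a = 0 -> g b = 0 -> f b != 0 -> g a != 0 ->
  D (a ^+ 2 + 3%:R * b ^+ 2) = 0 -> D a = 0 /\ D b = 0.
Proof.
move=> leib nilp fcong gcong fa gb fb ga e.
have n2 : (2%:R : A) != 0 by rewrite -mpolyC_nat mpolyC_eq0 natr_pchar0.
have n3 : (3%:R : A) != 0 by rewrite -mpolyC_nat mpolyC_eq0 natr_pchar0.
rewrite mulr_natl raddfD raddfMn /= !expr2 !leib in e.
have {}e : a * D a = - (3%:R * (b * D b)).
  apply: (mulfI n2); apply/eqP; rewrite -subr_eq0 -[X in _ == X]e.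
  by apply/eqP; ring.
have [u uE] : exists u, D a = b * u.
  have [u uE] := gcong (D a); exists u; rewrite {1}uE.
  suff -> : g (D a) = 0 by rewrite add0r.
  by apply: (mulfI ga); rewrite -rmorphM e rmorphN !rmorphM gb mul0r !mulr0 oppr0.
have [v vE] : exists v, D b = a * v.
  have [v vE] := fcong (D b); exists v; rewrite {1}vE.
  suff -> : f (D b) = 0 by rewrite add0r.
  apply: (mulfI fb); apply: (mulfI n3).
  rewrite -{1}(rmorph_nat f) -!rmorphM -[_ * _]opprK -e rmorphN rmorphM fa.
  by rewrite mul0r !mulr0 oppr0.
have [psi [psi0 psiD psiC]] := flow_exists char0 leib nilp.
have nz w : w != 0 -> psi w != 0.
  by apply: contraNneq => w0; rewrite -(psi0 w) w0 coef0.
have a0 : a != 0 by apply: contraNneq ga => ->; rewrite rmorph0.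
have b0 : b != 0 by apply: contraNneq fb => ->; rewrite rmorph0.
have lt w r t : w != 0 -> D w = r * t -> t != 0 -> (size (psi r) < size (psi w))%N.
  move=> w0 Dw t0; apply: leq_ltn_trans (lt_size_deriv (nz _ w0)).
  have [->|r0] := eqVneq r 0; first by rewrite rmorph0 size_poly0.
  rewrite psiD Dw rmorphM size_mul ?nz // -(prednK (_ : 0 < size (psi t))%N) ?size_poly_gt0 ?nz //.
  by rewrite addnS leq_addr.
have [u0|un0] := eqVneq u 0.
  rewrite u0 mulr0 in uE; split=> //; move/esym/eqP: e.
  by rewrite uE mulr0 oppr_eq0 !mulf_eq0 (negPf n3) (negPf b0) => /eqP.
have [v0|vn0] := eqVneq v 0.
  rewrite v0 mulr0 in vE; split=> //; move/eqP: e.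
  by rewrite vE !mulr0 oppr0 mulf_eq0 (negPf a0) => /eqP.
by have := ltn_trans (lt _ _ _ a0 uE un0) (lt _ _ _ b0 vE vn0); rewrite ltnn.
Qed.

(** With Z = alpha z, the cubic is x^3 + y^3 + Z^3 - 3xyZ = l q, where
    l = x + y + Z and 4q = (2x - y - Z)^2 + 3(y - Z)^2. Both factors are killed
    by D. Over K, q need not split into linear forms, but D kills the two forms
    in the sum of squares; with l they span all linear forms. *)
Lemma nodal_case al D : al ^+ 3 = 1 ->
  leibniz D -> locally_nilpotent D ->
  D (hesse_cubic al) = 0 -> forall i, D 'X_i = 0.
Proof.
move=> al3 leib nilp Dc.
pose t : A := al%:MP.
have t3 : t ^+ 3 = 1 by rewrite /t -rmorphXn al3.
pose z := t * vz.
pose l : A := vx + vy + z.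
pose q : A := vx ^+ 2 + vy ^+ 2 + z ^+ 2 - vx * vy - vy * z - z * vx.
have cE : hesse_cubic al = l * q.
  rewrite /hesse_cubic mpolyCM mpolyC_nat -/t.
  transitivity (vx ^+ 3 + vy ^+ 3 + t ^+ 3 * vz ^+ 3 - 3%:R * t * (vx * vy * vz)).
    by rewrite t3 mul1r.
  by rewrite /l /q /z; ring.
have c0 := hesse_neq0 al; rewrite cE in c0 Dc.
have Dl : D l = 0 := factorially_closed leib nilp c0 Dc.
have Dq : D q = 0.
  by apply: (factorially_closed (b := l) leib nilp); rewrite mulrC.
pose a : A := 2%:R * vx - vy - z.
pose b : A := vy - z.
have Dab : D (a ^+ 2 + 3%:R * b ^+ 2) = 0.
  have -> : a ^+ 2 + 3%:R * b ^+ 2 = q *+ 4 by rewrite /a /b /q; ring.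
  by rewrite raddfMn /= Dq mul0rn.
pose half : A := (2%:R^-1)%:MP.
have halfE : half * 2%:R = 1.
  by rewrite /half -mpolyC_nat -mpolyCM mulVf ?natr_pchar0 // mpolyC1.
pose hf i : A := if i == 0 then half * (vy + z) else 'X_i.
pose hg i : A := if i == 1 then z else 'X_i.
have subz h : h 2 = 'X_2 -> subst h z = z by move=> h2; rewrite rmorphM /= substC substX h2.
have sg1 : subst hg vy = z by rewrite substX.
have sg0 : subst hg vx = vx by rewrite substX.
have sf1 : subst hf vy = vy by rewrite substX.
have sf0 : subst hf vx = half * (vy + z) by rewrite substX.
have k0 u : kill 2 u != 0 -> u != 0 by apply: contraNneq => ->; rewrite rmorph0.
have k2z : kill 2 z = 0 by rewrite rmorphM /= killX eqxx mulr0.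
have [Da Db] : D a = 0 /\ D b = 0.
  apply: (derivation_sum_squares (f := subst hf) (g := subst hg) leib nilp) => //=.
  - apply: subst_congr => [k|i]; first exact: substC.
    rewrite /= substX /hf; case: eqP => [->|_]; last by exists 0; rewrite mulr0 addr0.
    exists half; rewrite /a -/vx; transitivity (half * 2%:R * vx); last by ring.
    by rewrite halfE mul1r.
  - apply: subst_congr => [k|i]; first exact: substC.
    rewrite /= substX /hg; case: eqP => [->|_]; last by exists 0; rewrite mulr0 addr0.
    by exists 1; rewrite /b -/vy; ring.
  - rewrite /a !rmorphB rmorphM rmorph_nat /= sf0 sf1 subz //.
    by rewrite mulrA (mulrC _ half) halfE; ring.
  - by rewrite /b rmorphB /= sg1 subz // subrr.
  - rewrite /b rmorphB /= sf1 subz //; apply: k0.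
    by rewrite rmorphB /= k2z subr0 killX mpolyX_neq0.
  - rewrite /a !rmorphB rmorphM rmorph_nat /= sg0 sg1 subz //; apply: k0.
    rewrite !rmorphB rmorphM rmorph_nat /= k2z !subr0 killX mulf_neq0 ?mpolyX_neq0 //.
    by rewrite -mpolyC_nat mpolyC_eq0 natr_pchar0.
have tor n u : D (u *+ n.+1) = 0 -> D u = 0.
  by rewrite raddfMn => e; apply: (natr_mulIf char0 (n := n)); rewrite /= mul0rn.
have Dx : D vx = 0.
  apply: (tor 2); have -> : vx *+ 3 = l + a by rewrite /l /a; ring.
  by rewrite raddfD /= Dl Da addr0.
have Dy : D vy = 0.
  apply: (tor 1); have -> : vy *+ 2 = l - vx + b by rewrite /l /b; ring.
  by rewrite raddfD raddfB /= Dl Db Dx subr0 addr0.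
have Dz : D vz = 0.
  have Dz : D z = 0.
    have -> : z = vy - b by rewrite /b opprB addrC subrK.
    by rewrite raddfB /= Dy Db subr0.
  have t0 : t != 0 by apply: contraTneq isT => t0; move/eqP: t3; rewrite t0 expr0n eq_sym oner_eq0.
  by apply: (mulfI t0); rewrite mulr0 -Dz leib derivationC // mul0r add0r.
by move=> i; have [->|->|->] := I3P i.
Qed.

End Nodal.

(** * Casimirs and the conclusion *)

Section Casimir.
Variables (K : fieldType) (al : K).
Hypotheses (char0 : [pchar K] =i pred0).
Local Notation A := {mpoly K[3]}.
Implicit Type D : {linear A -> A}.
Local Notation C := (elliptic_cubic al).
Local Notation br := (elliptic_bracket al).

Definition casimir (w : A) := forall u, br u w = 0.

Lemma hesse_elliptic : hesse_cubic al = 3%:R *: C.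
Proof.
rewrite /elliptic_cubic scalerBr scalerA mulfV ?natr_pchar0 // scale1r.
by rewrite /hesse_cubic mul_mpolyC scalerA.
Qed.

Lemma casimir_cubic : casimir C.
Proof. by move=> u; rewrite /elliptic_bracket jacobianE; ring. Qed.

Lemma casimir_derivation D w : poisson_derivation br D -> casimir w -> casimir (D w).
Proof.
by move=> [_ brD] cw u; have := brD u w; rewrite !cw raddf0 add0r => <-.
Qed.

(** The brackets of w with the variables are the entries of grad w x grad C. *)
Lemma casimir_gradient w : casimir w -> forall i j : 'I_3,
  C^`M(i) * w^`M(j) = C^`M(j) * w^`M(i).
Proof.
move=> cw.
have := cw vz; have := cw vy; have := cw vx.
rewrite /elliptic_bracket !jacobianE !mderivXi /= !(mul0r, mul1r, subr0, sub0r, add0r, addr0).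
move=> e12 e20 e01 i j.
have {}e12 : C^`M(1 : 'I_3) * w^`M(2 : 'I_3) = C^`M(2 : 'I_3) * w^`M(1 : 'I_3).
  by apply/esym/eqP; rewrite -subr_eq0 -[X in _ == X]e12; apply/eqP; ring.
have {}e20 : C^`M(0 : 'I_3) * w^`M(2 : 'I_3) = C^`M(2 : 'I_3) * w^`M(0 : 'I_3).
  by apply/eqP; rewrite -subr_eq0 -[X in _ == X]e20; apply/eqP; ring.
have {}e01 : C^`M(0 : 'I_3) * w^`M(1 : 'I_3) = C^`M(1 : 'I_3) * w^`M(0 : 'I_3).
  by apply/esym/eqP; rewrite -subr_eq0 -[X in _ == X]e01; apply/eqP; ring.
by have [->|->|->] := I3P i; have [->|->|->] := I3P j.
Qed.

Lemma casimir_derivative D w : leibniz D ->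
  casimir w -> forall i, C^`M(i) * D w = w^`M(i) * D C.
Proof.
move=> leib cw i; rewrite !(derivationE leib) /vfield !mulr_sumr.
by apply: eq_bigr => j _; rewrite mulrCA (casimir_gradient cw); ring.
Qed.

Lemma mderiv_eq0 (w : A) : (forall i, w^`M(i) = 0) -> w = (w@_0)%:MP.
Proof.
move=> w0; apply/mpolyP => m; rewrite mcoeffC.
have [->|m0] := eqVneq m 0%MM; first by rewrite mulr1.
have [i mi] : exists i, m i != 0%N.
  apply/existsP; rewrite -negb_forall; apply: contraNN m0 => /forallP h.
  by apply/eqP/mnmP => i; rewrite mnm0E; apply/eqP.
rewrite mulr0.
have := congr1 (fun p : A => p@_(m - U_(i))%MM) (w0 i).
rewrite mcoeff_deriv mcoeff0 submK ?lep1mP // -mulr_natr => /eqP.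
by rewrite mulf_eq0 (negPf (natr_pchar0 char0 _)) orbF => /eqP.
Qed.

(** The value on the right is that of q at the origin. At z = 0 the two partial
    derivatives become x ^+ 2 and y ^+ 2, so that the restriction of q to this
    plane, dividing both, is a nonzero constant. *)
Lemma cubic_gradient_coprime (q t0 t1 : A) (k : K) : k != 0 ->
  C^`M(0 : 'I_3) * k%:MP = t0 * q -> C^`M(1 : 'I_3) * k%:MP = t1 * q ->
  ((to_iterated q).[0]).[0].[0] != 0.
Proof.
move=> k0; have [-> -> _] := elliptic_cubic_deriv al char0.
pose g : {rmorphism A -> {poly {poly K}}} := horner_eval 0 \o @to_iterated K.
have gX i : g 'X_i = (iterated_var K i).[0] by rewrite /g /= to_iteratedX.
have gC c : g c%:MP = c%:P%:P by rewrite /g /= to_iteratedC horner_evalE hornerC.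
have [gx gy gz] : [/\ g vx = 'X%:P, g vy = 'X & g vz = 0].
  by rewrite !gX /iterated_var /= !hornerC hornerX.
have g0 : g (vx ^+ 2 - al *: (vy * vz)) = 'X%:P ^+ 2.
  by rewrite -mul_mpolyC rmorphB !(rmorphM g) gz !mulr0 subr0 gx expr2.
have g1 : g (vy ^+ 2 - al *: (vz * vx)) = 'X ^+ 2.
  by rewrite -mul_mpolyC rmorphB !(rmorphM g) gz mul0r mulr0 subr0 gy expr2.
move=> /(congr1 g) + /(congr1 g); rewrite !(rmorphM g) g0 g1 gC.
rewrite -polyC_exp -polyCM => e0 e1; rewrite -[(to_iterated q).[0]]/(g q).
have kP : k%:P != 0 :> {poly K} by rewrite polyC_eq0.
have [u qu] : exists u, g q = u%:P.
  have : g t0 * g q != 0 by rewrite -e0 polyC_eq0 mulf_neq0 ?expf_neq0 ?polyX_eq0.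
  rewrite mulf_eq0 negb_or => /andP[t0n qn].
  have := congr1 (fun p : {poly {poly K}} => size p) e0.
  rewrite size_polyC size_mul // mulf_neq0 ?expf_neq0 ?polyX_eq0 // => sz.
  exists (g q)`_0; apply: size1_polyC; move: sz t0n qn; rewrite -!size_poly_gt0.
  by move: (size (g t0)) (size (g q)) => m n; lia.
rewrite qu hornerC; move: e1; rewrite qu => /(congr1 (fun p : {poly {poly K}} => p`_2)).
rewrite coefMC coefXn mul1r coefMC => e1.
have : (g t1)`_2 * u != 0 by rewrite -e1.
rewrite mulf_eq0 negb_or => /andP[t1n un].
have := congr1 (fun p : {poly K} => size p) e1; rewrite size_polyC k0 size_mul // => sz.
have su : (size u <= 1)%N.
  move: sz t1n un; rewrite -!size_poly_gt0.
  by move: (size (g t1)`_2) (size u) => m n; lia.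
by rewrite (size1_polyC su) hornerC -polyC_eq0 -size1_polyC.
Qed.

(** Let C be the Casimir, s the last nonzero iterate D^k C, with k > 0, and
    t = D^(k-1) C. Both are Casimirs, so [casimir_derivative] applies: as D s = 0,
    the gradient of s vanishes and s is a constant; then s grad C = (DC) grad t,
    and [cubic_gradient_coprime] says that DC does not vanish at the origin.
    But DC lies in the ideal of the partial derivatives of C, which vanish
    there. *)
Lemma derivation_cubic D : poisson_derivation br D -> locally_nilpotent D -> D C = 0.
Proof.
move=> PD nilp; have [leib _] := PD.
have casD n : casimir (iter n D C).
  by elim: n => [|n IH] /=; [exact: casimir_cubic | exact: casimir_derivation].
have nilpb : exists m, iter m D C == 0 by have [m e] := nilp C; exists m; apply/eqP.
have C0 : C != 0.
  by apply: contraNneq (hesse_neq0 al) => C0; rewrite hesse_elliptic C0 scaler0.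
apply/eqP/negPn/negP => DC0.
case: (ex_minnP nilpb) => -[|[|m]] /eqP em minm; first by rewrite -em eqxx in C0.
  by rewrite -em eqxx in DC0.
set s := iter m.+1 D C.
have s0 : s != 0 by apply: contraTneq isT => /eqP /minm; rewrite ltnn.
have sk : s = (s@_0)%:MP.
  apply: mderiv_eq0 => i; apply: (mulIf DC0); rewrite mul0r.
  rewrite -(casimir_derivative leib (casD m.+1)) -/s.
  by rewrite (_ : D s = 0) ?mulr0.
have k0 : s@_0 != 0 by apply: contraNneq s0 => k0; rewrite sk k0 mpolyC0.
have et i := casimir_derivative leib (casD m) i.
have sE : D (iter m D C) = (s@_0)%:MP by rewrite -sk.
rewrite sE in et.
have := cubic_gradient_coprime k0 (et 0) (et 1).
pose ev : {rmorphism A -> K} := horner_eval 0 \o (horner_eval 0 \o (horner_eval 0 \o @to_iterated K)).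
rewrite -[_.[0]]/(ev (D C)) => /negP; apply; apply/eqP.
have ev0 i : ev 'X_i = 0.
  rewrite /ev /= to_iteratedX /iterated_var !horner_evalE.
  by have [->|->|->] := I3P i; rewrite /= ?(hornerC, hornerX).
rewrite (derivationE leib) /vfield rmorph_sum big1 // => i _; rewrite rmorphM.
have [d0 d1 d2] := elliptic_cubic_deriv al char0.
suff -> : ev C^`M(i) = 0 by rewrite mulr0.
have [->|->|->] := I3P i; rewrite (d0, d1, d2) -mul_mpolyC rmorphB rmorphXn !rmorphM !ev0;
  by rewrite expr0n !mulr0 subr0.
Qed.

End Casimir.

Theorem corollary1 (K : fieldType) (char0 : [pchar K] =i pred0) (alpha : K)
    (D : {linear {mpoly K[3]} -> {mpoly K[3]}}) :
  poisson_derivation (elliptic_bracket alpha) D ->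
  locally_nilpotent D ->
  forall a : {mpoly K[3]}, D a = 0.
Proof.
move=> PD nilp a; have [leib _] := PD.
have Dc : D (hesse_cubic alpha) = 0.
  by rewrite hesse_elliptic // linearZ /= derivation_cubic // scaler0.
have DX : forall i, D 'X_i = 0.
  have [al3|al3] := eqVneq (alpha ^+ 3) 1; first exact: nodal_case Dc.
  exact: smooth_case Dc.
by rewrite (derivationE leib) /vfield big1 // => i _; rewrite DX mul0r.
Qed.
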